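(* Let $G$ be a finite non-abelian simple group and let $k\geqslant 2$. Then the Andrews--Curtis graph $\Delta_k(G,G)$ is connected and $$\operatorname{diam}(\Delta_k(G,G))\leqslant 4\bigl(k\cdot \mathrm{or}(G)+\mathrm{cn}(G)\bigr).$$
   Context: For a group $G$ and an integer $k\geqslant 1$, the Andrews--Curtis graph $\Delta_k(G,G)$ is the undirected graph whose vertices are the $k$-tuples $(h_1,\ldots,h_k)\in G^k$ that generate $G$ as a normal subgroup, i.e. the normal closure $\langle h_1^G,\ldots,h_k^G\rangle$ of $\{h_1,\ldots,h_k\}$ equals $G$. Two vertices are joined by an edge if one is obtained from the other by one of the following moves, each changing only the $i$-th component: $x_i\mapsto x_ix_j^{\pm1}$ ($i\ne j$); $x_i\mapsto x_j^{\pm1}x_i$ ($i\neq j$); $x_i\mapsto x_i^{-1}$; $x_i\mapsto x_i^w=w^{-1}x_iw$ for an arbitrary $w\in G$. A graph is connected if any two of its vertices are joined by a path, and $\operatorname{diam}$ denotes the diameter with respect to the path (edge-count) distance. For a subset $C\subset G$ write $C^n=\{c_1c_2\cdots c_n\mid c_i\in C\}$. The covering number of a finite non-abelian simple group $G$ is $\mathrm{cn}(G)=\min\{n\mid C^n=G \text{ for every conjugacy class } C\subset G,\ C\neq\{1\}\}$. The Ore constant is $\mathrm{or}(G)=\min\{n\mid C^n=G\text{ for some conjugacy class } C\subset G\}$. *)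

(* Defs.v *)
From mathcomp Require Import all_boot all_fingroup all_solvable.

Set Implicit Arguments.
Unset Strict Implicit.
Unset Printing Implicit Defensive.

Import GroupScope.

Section Graph.

Variables (T : finType) (e : rel T).

Definition graph_connected : Prop := forall x y : T, connect e x y.

Definition walk_of_length (n : nat) (x y : T) : bool :=
  [exists p : n.-tuple T, path e x p && (last x p == y)].

(* A shortest walk repeats no vertex, hence has fewer than #|T| edges; the    *)
(* value is #|T| exactly when x and y are not joined by any walk.             *)
Definition graph_dist (x y : T) : nat :=
  find (fun n => walk_of_length n x y) (iota 0 #|T|).

Definition graph_diam : nat := \max_(x : T) \max_(y : T) graph_dist x y.

End Graph.

Section AndrewsCurtis.

Variables (gT : finGroupType) (G : {group gT}) (k : nat).

Implicit Types h g : {ffun 'I_k -> gT}.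

Definition normal_closure (A : {set gT}) : {set gT} := <<class_support A G>>.

Definition AC_vertex h : bool :=
  [forall i, h i \in G] && (normal_closure [set h i | i : 'I_k] == G).

Definition AC_move h g : bool :=
  [exists i : 'I_k,
    [forall (l | l != i), g l == h l] &&
    [|| [exists (j | j != i),
           [|| g i == h i * h j, g i == h i * (h j)^-1,
               g i == h j * h i | g i == (h j)^-1 * h i]],
        g i == (h i)^-1
      | [exists w in G, g i == h i ^ w]]].

Definition AC_graph : rel {h : {ffun 'I_k -> gT} | AC_vertex h} :=
  [rel u v | AC_move (val u) (val v) || AC_move (val v) (val u)].

End AndrewsCurtis.

Section CoveringNumber.

Variables (gT : finGroupType) (G : {group gT}).

(* C ^+ n is the set of n-fold products of elements of C, with C ^+ 0 = 1.    *)
Definition all_classes_cover (n : nat) : bool :=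
  [forall C in classes G, (C != 1) ==> (C ^+ n == G)].

Definition some_class_covers (n : nat) : bool :=
  [exists C in classes G, C ^+ n == G].

Hypotheses (simpleG : simple G) (nabG : ~~ abelian G).

Lemma class_covers_eventually (C : {set gT}) :
  C \in classes G -> C != 1 -> exists n, forall m, n <= m -> C ^+ m = G.
Proof.
case/imsetP=> x Gx -> {C} ntC; set C := x ^: G in ntC *.
have [_ minG] := simpleP _ simpleG.
have sCG : C \subset G by rewrite class_subG.
have Cx : x \in C by apply: class_refl.
have sXG n : C ^+ n \subset G.
  elim: n => [|n IHn]; first by rewrite expg0 sub1G.
  by rewrite expgS -(mulGid G) mulgSS.
have nCG : G \subset 'N(C) by apply: class_norm.
have nXG n : G \subset 'N(C ^+ n).
  elim: n => [|n IHn]; first by rewrite expg0 norms1.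
  by rewrite expgS normsM.
pose D := C ^+ #[x].
have Xx n : x ^+ n \in C ^+ n.
  elim: n => [|n IHn]; first by rewrite inE.
  by rewrite !expgS mem_mulg.
have D1 : 1 \in D by rewrite -(expg_order x) Xx.
have ntD : <<D>> != 1.
  apply/eqP=> /eqP; rewrite -subG1 gen_subG => sD1.
  have le_C n : #|C| <= #|C ^+ n.+1|.
    rewrite expgSr -(card_lcoset C (x ^+ n)) subset_leq_card //.
    by rewrite mulSg // sub1set Xx.
  have: #|C| <= 1.
    apply: leq_trans (le_C #[x].-1) _.
    by rewrite prednK ?order_gt0 // -(cards1 (1 : gT)) subset_leq_card.
  move=> leC1.
  have defC : C = [set x].
    by apply/eqP; rewrite eq_sym eqEcard sub1set Cx cards1.
  have ZGx : x \in 'Z(G).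
    apply/centerP; split=> // y Gy; apply/commgP/conjg_fixP.
    by apply/set1P; rewrite -defC memJ_class.
  have [Z1|ZG] := minG _ (center_normal G).
    by move: ZGx ntC; rewrite Z1 defC => /set1P->; rewrite eqxx.
  by move: nabG; rewrite /abelian -{1}ZG subsetIr.
have defG : <<D>> = G.
  have nDG : <<D>> <| G by rewrite /normal gen_subG sXG norms_gen ?nXG.
  by have [D0|] := minG _ nDG; first by rewrite D0 eqxx in ntD.
have monD a b : a <= b -> D ^+ a \subset D ^+ b.
  move/subnK <-; elim: (b - a) => [|c IHc]; first by rewrite add0n.
  by rewrite addSn expgS; apply: subset_trans IHc (mulg_subr _ D1).
have ex_n g : exists n, (g \in G) ==> (g \in D ^+ n).
  case Gg: (g \in G); last by exists 0%N.
  move: Gg; rewrite -defG => /gen_prodgP[n [c Dc ->]]; exists n; rewrite implyTb.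
  elim: n c Dc => [|n IHn] c Dc; first by rewrite big_ord0 expg0 set11.
  by rewrite big_ord_recl expgS mem_mulg // IHn // => i; apply: Dc.
pose N := \max_(g : gT) ex_minn (ex_n g).
have DN : D ^+ N = G.
  apply/eqP; rewrite eqEsubset /D -expgM sXG /=; apply/subsetP=> g Gg.
  rewrite expgM; apply: (subsetP (monD _ _ (leq_bigmax g))).
  by case: ex_minnP => n /implyP/(_ Gg).
exists (#[x] * N)%N => m /subnK <-; elim: (m - _)%N => [|c IHc].
  by rewrite add0n expgM.
rewrite addSn expgS IHc; apply/eqP.
rewrite eqEsubset -{2}(mulGid G) mulSg //=.
by rewrite -{1}(lcoset_id Gx) mulSg ?sub1set.
Qed.

Lemma all_classes_cover_exists : exists n, all_classes_cover n.
Proof.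
have ex_n (C : {set gT}) : exists n,
    (C \in classes G) && (C != 1) -> forall m, n <= m -> C ^+ m = G.
  case: (boolP ((C \in classes G) && (C != 1))) => [/andP[GC ntC]|_].
    by have [n Hn] := class_covers_eventually GC ntC; exists n.
  by exists 0%N.
have [f Hf] := fin_all_exists ex_n.
exists (\max_C f C); apply/forall_inP=> C GC; apply/implyP=> ntC.
by apply/eqP/(Hf C); [rewrite GC | apply: leq_bigmax].
Qed.

Lemma some_class_covers_exists : exists n, some_class_covers n.
Proof.
have [n /forall_inP cov_n] := all_classes_cover_exists; exists n.
have [ntG _] := simpleP _ simpleG; have [x Gx ntx] := trivgPn _ ntG.
apply/exists_inP; exists (x ^: G); first exact: mem_classes.
apply: (implyP (cov_n _ (mem_classes Gx))).
by apply: contraNneq ntx => C1; apply/eqP/set1gP; rewrite -C1 class_refl.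
Qed.

Definition covering_number : nat := ex_minn all_classes_cover_exists.

Definition ore_constant : nat := ex_minn some_class_covers_exists.

End CoveringNumber.

(* Main.v *)
Require Import Defs.
From mathcomp Require Import all_boot all_fingroup all_solvable.
From mathcomp Require Import zify.

Set Implicit Arguments.
Unset Strict Implicit.
Unset Printing Implicit Defensive.

(** Call a class C covering in n steps if C^n = G. If the j-th entry of a tuple
    lies in such a class, then 2n moves turn the i-th entry (i != j) into any
    prescribed t in G: write h_i^-1 t = d_1 ... d_n with d_m in C, and
    alternately conjugate h_j to d_m and multiply h_i by it. Starting from two
    vertices, use a nontrivial entry of each to install an element c of the Ore
    class (2 cn moves for each vertex). With c available, rewrite all the other
    entries of the first tuple to those of the second (2 (k - 1) or moves); if
    the second tuple has its copy of c elsewhere, that copy has now been created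
    and rewrites the last entry (2 or moves). One final conjugation gives a path
    of length at most 4 cn + 2 k or + 1. *)

Section Joined.

Variables (T : finType) (e : rel T).

(** An upper bound on length adds up under concatenation and also witnesses connectivity. A bound on
    [graph_dist] alone would not, since that function returns [#|T|] on unconnected pairs. *)
Definition joined (n : nat) (x y : T) : Prop :=
  exists p, [/\ size p <= n, path e x p & last x p = y].

Lemma joined_refl n x : joined n x x.
Proof. by exists [::]. Qed.

Lemma joined_edge x y : e x y -> joined 1 x y.
Proof. by move=> exy; exists [:: y]; rewrite /= exy. Qed.

Lemma joined_trans m n x y z :
  joined m x y -> joined n y z -> joined (m + n) x z.
Proof.
move=> [p [sp ep lp]] [q [sq eq lq]]; exists (p ++ q).
by rewrite size_cat leq_add // cat_path ep last_cat lp.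
Qed.

Lemma joined_le m n x y : m <= n -> joined m x y -> joined n x y.
Proof. by move=> lemn [p [sp ep lp]]; exists p; rewrite (leq_trans sp). Qed.

Lemma joined_sym n x y : symmetric e -> joined n x y -> joined n y x.
Proof.
move=> sym_e [p [sp ep <-]]; exists (rev (belast x p)); split.
- by rewrite size_rev size_belast.
- by rewrite rev_path (eq_path (e' := e)).
by case: p {sp ep} => //= z p; rewrite rev_cons last_rcons.
Qed.

Lemma joined_connect n x y : joined n x y -> connect e x y.
Proof. by move=> [p [_ ep lp]]; apply/connectP; exists p. Qed.

Lemma joined_dist n x y : joined n x y -> graph_dist e x y <= n.
Proof.
move=> [p [sp ep lp]]; apply: leq_trans sp; rewrite /graph_dist.
set a := fun n : nat => _.
(* [find] searches only lengths below [#|T|], and its default value [#|T|] already bounds the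
   distance when the path is longer. *)
have [ltpT|leTp] := ltnP (size p) #|T|; last first.
  by apply: leq_trans leTp; rewrite -{2}(size_iota 0 #|T|) find_size.
rewrite leqNgt; apply/negP=> /(before_find 0); rewrite nth_iota // add0n.
by case/existsP; exists (in_tuple p); rewrite ep lp /=.
Qed.

End Joined.

Section Moves.

Local Open Scope group_scope.

Variables (gT : finGroupType) (G : {group gT}) (k : nat).
Hypothesis simpleG : simple G.

Implicit Types (h g : {ffun 'I_k -> gT}).
Local Notation vertex := {h : {ffun 'I_k -> gT} | AC_vertex G h}.
Implicit Types u v : vertex.
Local Notation joined := (joined (@AC_graph gT G k)).

Lemma AC_graph_sym : symmetric (@AC_graph gT G k).
Proof. by move=> u v; exact: orbC. Qed.

(** The normal closure of the entries is normal in the simple group [G], so it is [G] as soon as it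
    is nontrivial. Staying inside the graph thus reduces to keeping one entry different from 1. *)
Lemma AC_vertexP h :
  reflect ((forall i, h i \in G) /\ exists i, h i != 1) (AC_vertex G h).
Proof.
have [ntG minG] := simpleP _ simpleG.
apply: (iffP andP) => [[/forallP Gh /eqP clG] | [Gh [i nti]]]; split=> //.
- apply/existsP; apply: contraNT ntG; rewrite negb_exists => /forallP h1.
  rewrite -clG -subG1 gen_subG.
  apply/subsetP=> _ /imset2P[_ y /imsetP[i _ ->] _ ->].
  by have := h1 i; rewrite negbK => /eqP->; rewrite conj1g inE.
- exact/forallP.
set A := [set _ | _ in _].
have sAG : A \subset G by apply/subsetP=> _ /imsetP[j _ ->].
have nclG : normal_closure G A <| G.
  rewrite /normal norms_gen ?class_support_norm // gen_subG.
  by rewrite class_support_sub_norm // normG.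
have [cl1|] := minG _ nclG; last by rewrite /= => <-.
case/negP: nti; rewrite -in_set1 -[[set 1]]cl1.
apply/mem_gen/imset2P; exists (h i) 1 => //; last by rewrite conjg1.
exact: imset_f.
Qed.

Lemma vertex_in u i : val u i \in G.
Proof. by case/AC_vertexP: (valP u). Qed.

Lemma vertex_neq1 u : exists i, val u i != 1.
Proof. by case/AC_vertexP: (valP u). Qed.

Definition update h i a : {ffun 'I_k -> gT} :=
  [ffun l => if l == i then a else h l].

Lemma update_eq h i a : update h i a i = a.
Proof. by rewrite ffunE eqxx. Qed.

Lemma update_neq h i a l : l != i -> update h i a l = h l.
Proof. by rewrite ffunE => /negPf->. Qed.

Lemma update_others h i a : [forall (l | l != i), update h i a l == h l].
Proof. by apply/forall_inP=> l li; rewrite update_neq. Qed.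

Lemma joined_move u g :
  AC_move G (val u) g -> AC_vertex G g ->
  exists2 v, joined 1 u v & val v = g.
Proof.
move=> mug Vg; exists (Sub g Vg); last exact: SubK.
by apply: joined_edge; apply/orP; left; rewrite SubK.
Qed.

Lemma joined_conj u i w :
  w \in G -> exists2 v, joined 1 u v & val v = update (val u) i (val u i ^ w).
Proof.
move=> Gw; apply: joined_move.
  apply/existsP; exists i; rewrite update_others update_eq /=.
  by apply/or3P/Or33/exists_inP; exists w.
apply/AC_vertexP; split=> [l|].
  by rewrite ffunE; case: eqP => _; rewrite ?groupJ ?vertex_in.
have [l ntl] := vertex_neq1 u; exists l; rewrite ffunE.
by have [<-|//] := eqVneq l i; rewrite conjg_eq1.
Qed.

Lemma joined_mul u i j :
  i != j -> val u j != 1 ->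
  exists2 v, joined 1 u v & val v = update (val u) i (val u i * val u j).
Proof.
move=> ij ntj; apply: joined_move.
  apply/existsP; exists i; rewrite update_others update_eq /=.
  by apply/or3P/Or31/exists_inP; exists j; rewrite 1?eq_sym // eqxx.
apply/AC_vertexP; split=> [l|].
  by rewrite ffunE; case: eqP => _; rewrite ?groupM ?vertex_in.
by exists j; rewrite update_neq // eq_sym.
Qed.

Variables (x : gT) (n : nat).
Hypothesis ntx : x != 1.

(** Each factor of [a] costs two moves. Entry [j] becomes each factor in turn, so only its conjugacy
    class survives as an invariant of the induction. *)
Lemma joined_mul_classes m u i j a :
    i != j -> val u j \in x ^: G -> a \in (x ^: G) ^+ m ->
  exists v, [/\ joined (2 * m) u v, val v i = val u i * a,
    val v j \in x ^: G & forall l, l != i -> l != j -> val v l = val u l].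
Proof.
move=> ij; elim: m u a => [|m IHm] u a uj.
  rewrite expg0 => /set1P->; exists u; rewrite mulg1; split=> //.
  exact: joined_refl.
rewrite expgS => /mulsgP[d b xd Db ->].
have ntd : d != 1 by case/imsetP: xd => y _ ->; rewrite conjg_eq1.
have /imsetP[w Gw dE] : d \in (val u j) ^: G by rewrite (class_eqP uj).
have [v1 uv1 v1E] := joined_conj u j Gw.
have v1j : val v1 j = d by rewrite v1E update_eq.
have ntv1j : val v1 j != 1 by rewrite v1j.
have [v2 v12 v2E] := joined_mul ij ntv1j.
have v2j : val v2 j \in x ^: G by rewrite v2E update_neq 1?eq_sym // v1j.
have [v [v2v vi vj vl]] := IHm _ _ v2j Db.
exists v; split=> //.
- rewrite mulnS; exact: joined_trans (joined_trans uv1 v12) v2v.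
- by rewrite vi v2E update_eq v1j v1E update_neq // mulgA.
by move=> l li lj; rewrite vl // v2E update_neq // v1E update_neq.
Qed.

Hypothesis covx : (x ^: G) ^+ n = G.

Lemma joined_set_entry u i j t :
    i != j -> val u j \in x ^: G -> t \in G ->
  exists v, [/\ joined (2 * n) u v, val v i = t,
    val v j \in x ^: G & forall l, l != i -> l != j -> val v l = val u l].
Proof.
move=> ij uj Gt.
have Da : (val u i)^-1 * t \in (x ^: G) ^+ n.
  by rewrite covx groupM ?groupV ?vertex_in.
have [v [uv vi vj vl]] := joined_mul_classes ij uj Da.
by exists v; split=> //; rewrite vi mulKVg.
Qed.

Lemma joined_set_entries u j (s : seq 'I_k) (t : 'I_k -> gT) :
    j \notin s -> val u j \in x ^: G -> (forall l, t l \in G) ->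
  exists v, [/\ joined (2 * n * size s) u v, val v j \in x ^: G &
    {in s, forall l, val v l = t l}].
Proof.
move=> js uj Gt; elim: s js => [|i s IHs].
  by exists u; split=> //; exact: joined_refl.
rewrite inE negb_or eq_sym => /andP[ij js].
have [v [uv vj vs]] := IHs js.
have [w [vw wi wj wl]] := joined_set_entry ij vj (Gt i).
exists w; split=> //.
  by rewrite /= mulnS addnC; apply: joined_trans uv vw.
move=> l; rewrite inE; have [-> //|li /= sl] := eqVneq l i.
by rewrite wl ?vs //; apply: contraNneq js => <-.
Qed.

Lemma joined_through_class u v i j :
    val u i \in x ^: G -> val v j \in x ^: G -> joined (2 * (k * n) + 1) u v.
Proof.
move=> ui vj.
have inC : i \notin enum (predC1 i) by rewrite mem_enum !inE eqxx.
have [w [uw wi wl]] := joined_set_entries inC ui (vertex_in v).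
have {}wl l : l != i -> val w l = val v l by move=> li; rewrite wl // mem_enum.
have k_gt0 : 0 < k := leq_ltn_trans (leq0n i) (ltn_ord i).
have sizeC : size (enum (predC1 i)) = k.-1.
  by rewrite -cardE cardC1 card_ord.
rewrite {}sizeC in uw.
(* Final step of both cases: if [z] and [v] differ at most at [l], where their entries are
   conjugate, one more move suffices. *)
have conj_v m z l : joined m u z -> m <= 2 * (k * n) ->
    val z l \in x ^: G -> val v l \in x ^: G ->
    (forall l', l' != l -> val z l' = val v l') -> joined (2 * (k * n) + 1) u v.
  move=> uz lem zl vl eq_zv.
  have /imsetP[y Gy vE] : val v l \in (val z l) ^: G by rewrite (class_eqP zl).
  have [z' zz' z'E] := joined_conj z l Gy.
  have <- : z' = v.
    apply/val_inj/ffunP=> l'; rewrite z'E ffunE.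
    by have [->|/eq_zv] := eqVneq l' l.
  exact: joined_trans (joined_le lem uz) zz'.
have [ij|ij] := eqVneq i j.
  by apply: (conj_v _ w i uw) => //; [lia | rewrite ij].
(* Off [i], [w] agrees with [v], so entry [j] is now in the covering class and can rewrite entry
   [i]. This shifts entry [j] within its class, which the last conjugation repairs. *)
have wj : val w j \in x ^: G by rewrite wl // eq_sym.
have [z [wz zi zj zl]] := joined_set_entry ij wj (vertex_in v i).
(* The cost so far is [2 * n * k.-1 + 2 * n], which equals [2 * (k * n)] because [k] is positive. *)
apply: (conj_v _ z j (joined_trans uw wz)) => //; first by nia.
by move=> l lj; have [->//|li] := eqVneq l i; rewrite zl // wl.
Qed.

End Moves.

(** The covering class is that of an arbitrary nontrivial entry, whence the covering number;
    [2 <= k] provides a second slot to receive [c]. Its position depends on [u], so two vertices may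
    get [c] in different places. *)
Lemma joined_install (gT : finGroupType) (G : {group gT}) (simpleG : simple G)
    (k : nat) (hk : 2 <= k) (m : nat) (c : gT) (u : {h | @AC_vertex gT G k h}) :
    all_classes_cover G m -> c \in G ->
  exists j v, joined (@AC_graph gT G k) (2 * m) u v /\ val v j = c.
Proof.
move=> /forall_inP covG Gc; have [i nti] := vertex_neq1 simpleG u.
have /existsP[j ji] : [exists j, j != i].
  have : 0 < #|predC1 i| by rewrite cardC1 card_ord; lia.
  by case/card_gt0P=> j ji; apply/existsP; exists j.
have Gui := vertex_in simpleG u i.
have ntC : (val u i ^: G != 1)%g.
  by apply: contraNneq nti => C1; apply/eqP/set1gP; rewrite -C1 class_refl.
have covC := eqP (implyP (covG _ (mem_classes Gui)) ntC).
have [v [uv vj _ _]] :=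
  joined_set_entry simpleG nti covC ji (class_refl _ _) Gc.
by exists j, v.
Qed.

Theorem proposition5p3 (gT : finGroupType) (G : {group gT})
    (simpleG : simple G) (nabG : ~~ abelian G) (k : nat) (hk : 2 <= k) :
  graph_connected (@AC_graph gT G k) /\
  graph_diam (@AC_graph gT G k) <=
    4 * (k * ore_constant simpleG nabG + covering_number simpleG nabG).
Proof.
set B := 4 * _; suff joinedB u v : joined (@AC_graph gT G k) B u v.
  split=> [u v|]; first exact: joined_connect (joinedB u v).
  by apply/bigmax_leqP=> u _; apply/bigmax_leqP=> v _; apply: joined_dist.
rewrite {}/B /ore_constant /covering_number.
case: ex_minnP => n /exists_inP[_ /imsetP[c Gc ->] /eqP covC] _.
case: ex_minnP => m covG _.
have [ntG _] := simpleP _ simpleG.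
(* Positivity of [n] lets the final estimate absorb the extra conjugation: [4 * m + 2 * (k * n) + 1]
   is at most [4 * (k * n + m)] once [k * n] is positive. *)
have n_gt0 : 0 < n.
  by case: n covC ntG => // <-; rewrite expg0 eqxx.
(* All powers of the class of 1 are trivial, whereas [G] is not. *)
have ntc : c != 1%g.
  apply: contraNneq ntG => c1; rewrite -covC c1 class1G.
  by apply/eqP; exact: expg1n.
have [i [u' [uu' u'i]]] := joined_install simpleG hk u covG Gc.
have [j [v' [vv' v'j]]] := joined_install simpleG hk v covG Gc.
have u'v' : joined (@AC_graph gT G k) (2 * (k * n) + 1) u' v'.
  by apply: (joined_through_class simpleG ntc covC (i := i) (j := j));
    rewrite ?u'i ?v'j class_refl.
have v'v := joined_sym (@AC_graph_sym _ _ _) vv'.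
apply: joined_le (joined_trans (joined_trans uu' u'v') v'v).
by nia.
Qed.
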